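(* Let $q$ be a power of a prime $p$, and let $f(x)=\sum_{n\geq 0}a_nx^n\in\mathbb{F}_q[[x]]$ be algebraic over $\mathbb{F}_q(x)$, of degree $d$ and height $h$. Then $$\mathrm{comp}_q(\mathbf{a})\leq (1+o(1))\,q^{(h+1)d+1},$$ where $\mathbf{a}=(a_n)_{n\geq 0}$ and the $o(1)$ term tends to $0$ when any one of $q$, $h$, or $d$ tends to infinity.
   Context: The degree of $f$ is $[\mathbb{F}_q(x)(f):\mathbb{F}_q(x)]$; the height of $f$ is the minimal degree in $x$ of a nonzero polynomial $P(x,y)\in\mathbb{F}_q[x,y]$ with $P(x,f(x))=0$. For a $q$-automatic sequence $\mathbf{a}$, $\mathrm{comp}_q(\mathbf{a})$ denotes the number of states of a minimal deterministic finite automaton with output which, given the base-$q$ expansion of $n$ read starting from the least significant digit, outputs $a_n$; equivalently, it equals the cardinality of the $q$-kernel $\{(a_{q^rn+j})_{n\geq 0} : r\geq 0,\ 0\leq j<q^r\}$. *)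

(* Defs.v *)
From HB Require Import structures.
From mathcomp Require Import all_boot all_order all_algebra.
From mathcomp Require Import generic_quotient fraction mxpoly.
From mathcomp Require Import boolp reals.

Set Implicit Arguments.
Unset Strict Implicit.
Unset Printing Implicit Defensive.

Import GRing.Theory.
Local Open Scope ring_scope.

Record fps (R : Type) := Fps { coefs : nat -> R }.

Arguments Fps {R} coefs.

Notation "{ 'fps' R }" := (fps R) (format "{ 'fps'  R }") : type_scope.

HB.instance Definition _ (R : Type) := gen_eqMixin {fps R}.
HB.instance Definition _ (R : Type) := gen_choiceMixin {fps R}.

Lemma fpsP (R : Type) (f g : {fps R}) : coefs f =1 coefs g -> f = g.
Proof. by case: f g => [f] [g] /= /funext ->. Qed.

Section FpsZmodule.
Variable R : zmodType.
Implicit Types f g : {fps R}.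

Definition fps_zero : {fps R} := Fps (fun=> 0).
Definition fps_opp f : {fps R} := Fps (fun n => - coefs f n).
Definition fps_add f g : {fps R} := Fps (fun n => coefs f n + coefs g n).

Fact fps_addA : associative fps_add.
Proof. by move=> f g h; apply: fpsP => n /=; rewrite addrA. Qed.
Fact fps_addC : commutative fps_add.
Proof. by move=> f g; apply: fpsP => n /=; rewrite addrC. Qed.
Fact fps_add0 : left_id fps_zero fps_add.
Proof. by move=> f; apply: fpsP => n /=; rewrite add0r. Qed.
Fact fps_addN : left_inverse fps_zero fps_opp fps_add.
Proof. by move=> f; apply: fpsP => n /=; rewrite addNr. Qed.

HB.instance Definition _ :=
  GRing.isZmodule.Build {fps R} fps_addA fps_addC fps_add0 fps_addN.

End FpsZmodule.

Section FpsRing.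
Variable R : comNzRingType.
Implicit Types f g : {fps R}.

Definition fps_one : {fps R} := Fps (fun n => (n == 0%N)%:R).
Definition fps_mul f g : {fps R} :=
  Fps (fun n => \sum_(i < n.+1) coefs f i * coefs g (n - i)%N).

Definition fps_trunc n f : {poly R} := \poly_(i < n.+1) coefs f i.

Lemma coef_fps_trunc n f i : (i <= n)%N -> (fps_trunc n f)`_i = coefs f i.
Proof. by move=> lein; rewrite coef_poly ltnS lein. Qed.

Lemma coefs_fps_mul n f g m : (m <= n)%N ->
  coefs (fps_mul f g) m = (fps_trunc n f * fps_trunc n g)`_m.
Proof.
move=> lemn; rewrite coefM /=; apply: eq_bigr => i _.
rewrite !coef_fps_trunc //; first exact: leq_trans (leq_subr _ _) lemn.
by apply: leq_trans lemn; rewrite -ltnS.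
Qed.

Fact fps_mulC : commutative fps_mul.
Proof.
by move=> f g; apply: fpsP => n; rewrite !(@coefs_fps_mul n) // mulrC.
Qed.

Fact fps_mulA : associative fps_mul.
Proof.
move=> f g h; apply: fpsP => n; rewrite [LHS](@coefs_fps_mul n) //.
rewrite [RHS](@coefs_fps_mul n) //.
transitivity ((fps_trunc n f * (fps_trunc n g * fps_trunc n h))`_n).
  rewrite !coefM; apply: eq_bigr => i _; congr (_ * _).
  by rewrite coef_fps_trunc ?leq_subr // (@coefs_fps_mul n) ?leq_subr.
rewrite mulrA !coefM; apply: eq_bigr => i _; congr (_ * _).
have le_in : (i <= n)%N by rewrite -ltnS.
by rewrite coef_fps_trunc // (@coefs_fps_mul n).
Qed.

Fact fps_mul1 : left_id fps_one fps_mul.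
Proof.
move=> f; apply: fpsP => n /=; rewrite big_ord_recl /= mul1r subn0.
by rewrite big1 ?addr0 // => i _; rewrite mul0r.
Qed.

Fact fps_mulDl : left_distributive fps_mul (@fps_add R).
Proof.
move=> f g h; apply: fpsP => n /=; rewrite -big_split /=.
by apply: eq_bigr => i _; rewrite mulrDl.
Qed.

Fact fps_one_neq0 : fps_one != fps_zero R.
Proof.
by apply/eqP => /(congr1 (fun f => coefs f 0%N)) /= /eqP; rewrite oner_eq0.
Qed.

HB.instance Definition _ := GRing.Zmodule_isComNzRing.Build {fps R}
  fps_mulA fps_mulC fps_mul1 fps_mulDl fps_one_neq0.

Lemma coefs0 n : coefs (0 : {fps R}) n = 0. Proof. by []. Qed.
Lemma coefs1 n : coefs (1 : {fps R}) n = (n == 0%N)%:R. Proof. by []. Qed.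
Lemma coefsN f n : coefs (- f) n = - coefs f n. Proof. by []. Qed.
Lemma coefsD f g n : coefs (f + g) n = coefs f n + coefs g n.
Proof. by []. Qed.
Lemma coefsM f g n :
  coefs (f * g) n = \sum_(i < n.+1) coefs f i * coefs g (n - i)%N.
Proof. by []. Qed.

Definition fps_unit : {pred {fps R}} := fun f => `[< exists g, g * f = 1 >].

Definition fps_inv f : {fps R} :=
  if pselect (exists g, g * f = 1) is left ex_inv then projT1 (cid ex_inv)
  else f.

Fact fps_mulVr : {in fps_unit, left_inverse 1 fps_inv *%R}.
Proof.
move=> f /asboolP f_unit; rewrite /fps_inv.
by case: pselect => // ex_inv; case: cid.
Qed.

Fact fps_unitP f g : g * f = 1 -> fps_unit f.
Proof. by move=> gf1; apply/asboolP; exists g. Qed.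

Fact fps_inv_out : {in [predC fps_unit], fps_inv =1 id}.
Proof.
move=> f /negP f_nunit; rewrite /fps_inv; case: pselect => // f_unit.
by case: f_nunit; apply/asboolP.
Qed.

HB.instance Definition _ := GRing.ComNzRing_hasMulInverse.Build {fps R}
  fps_mulVr fps_unitP fps_inv_out.

Definition fps_of_poly (p : {poly R}) : {fps R} := Fps (fun n => p`_n).

Fact fps_of_poly_is_zmod_morphism : zmod_morphism fps_of_poly.
Proof. by move=> p r; apply: fpsP => n; rewrite /= coefB. Qed.

Fact fps_of_poly_is_monoid_morphism : monoid_morphism fps_of_poly.
Proof.
split=> [|p r]; apply: fpsP => n; first by rewrite /= coef1.
by rewrite /= coefM.
Qed.

HB.instance Definition _ := GRing.isZmodMorphism.Build {poly R} {fps R}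
  fps_of_poly fps_of_poly_is_zmod_morphism.
HB.instance Definition _ := GRing.isMonoidMorphism.Build {poly R} {fps R}
  fps_of_poly fps_of_poly_is_monoid_morphism.

Lemma fps_of_poly_inj : injective fps_of_poly.
Proof. by move=> p r [] /funeqP eq_pr; apply/polyP. Qed.

End FpsRing.

Section FpsIdomain.
Variable R : idomainType.
Implicit Types f g : {fps R}.

Lemma fps_neq0_order f : f != 0 ->
  exists2 n, coefs f n != 0 & forall m, (m < n)%N -> coefs f m = 0.
Proof.
move=> f_neq0; have ex_n : exists n, coefs f n != 0.
  apply: contrapT => /forallNP f0; move/eqP: f_neq0; apply.
  by apply: fpsP => n; apply/eqP; apply: contra_notT (f0 n).
case: (ex_minnP ex_n) => n fn_neq0 min_n; exists n => // m.
by apply: contraTeq => /min_n; rewrite -leqNgt.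
Qed.

Fact fps_integral f g : f * g = 0 -> (f == 0) || (g == 0).
Proof.
move=> fg0; apply: contra_eqT fg0; rewrite negb_or => /andP[f_neq0 g_neq0].
have [m fm_neq0 min_m] := fps_neq0_order f_neq0.
have [n gn_neq0 min_n] := fps_neq0_order g_neq0.
apply/eqP => /(congr1 (fun u => coefs u (m + n)%N)); apply/eqP.
have lt_m : (m < (m + n).+1)%N by rewrite ltnS leq_addr.
rewrite coefsM coefs0 (bigD1 (Ordinal lt_m)) //= addKn big1 ?addr0.
  by rewrite mulf_neq0.
move=> i; rewrite -val_eqE /= neq_ltn => /orP[/min_m -> | lt_mi].
  by rewrite mul0r.
by rewrite [coefs g _]min_n ?mulr0 // ltn_subLR ?ltn_add2r // -ltnS.
Qed.

HB.instance Definition _ :=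
  GRing.ComUnitRing_isIntegral.Build {fps R} fps_integral.

End FpsIdomain.

Notation ratfun F := {fraction {poly F}}.
Notation laurent F := {fraction {fps F}}.

Section RatfunLaurent.
Variable F : fieldType.
Local Open Scope quotient_scope.
Local Notation "x %:F" := (FracField.tofrac x).

Definition laurent_of_poly (p : {poly F}) : laurent F := (fps_of_poly p)%:F.

(* By [laurent_of_ratfun_div] below, this does not depend on the numerator and
   denominator picked by [repr]. *)
Definition laurent_of_ratfun (u : ratfun F) : laurent F :=
  laurent_of_poly \n_(repr u) / laurent_of_poly \d_(repr u).

HB.instance Definition _ := GRing.RMorphism.copy laurent_of_poly
  (@FracField.tofrac {fps F} \o @fps_of_poly F).

Lemma laurent_of_poly_inj : injective laurent_of_poly.
Proof. by move=> p s /eqP; rewrite tofrac_eq => /eqP /fps_of_poly_inj. Qed.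

Lemma laurent_of_poly_eq0 p : (laurent_of_poly p == 0) = (p == 0).
Proof. exact: raddf_eq0 laurent_of_poly_inj. Qed.

Lemma ratfun_numden (u : ratfun F) : u = (\n_(repr u))%:F / (\d_(repr u))%:F.
Proof.
apply: (canRL (mulfK _)); first by rewrite tofrac_eq0 denom_ratioP.
move: (repr u) (reprK u) => r <-.
rewrite !piE; apply/eqP; rewrite FracField.equivf_def /FracField.equivf.
by rewrite /FracField.mulf !numden_Ratio ?mulf_neq0 ?oner_eq0 ?denom_ratioP //
  !mulr1 mulrC.
Qed.

Lemma laurent_of_ratfun_div (p s : {poly F}) : s != 0 ->
  laurent_of_ratfun (p%:F / s%:F) = laurent_of_poly p / laurent_of_poly s.
Proof.
move=> s_neq0; set u := p%:F / s%:F.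
have d_neq0 := denom_ratioP (repr u).
have /eqP := ratfun_numden u; rewrite {1}/u eqr_div ?tofrac_eq0 //.
rewrite -!tofracM tofrac_eq => /eqP eq_ps.
apply/eqP; rewrite /laurent_of_ratfun eqr_div ?laurent_of_poly_eq0 //.
by rewrite -!rmorphM -eq_ps.
Qed.

Lemma ratfunP (u : ratfun F) :
  exists p s : {poly F}, s != 0 /\ u = p%:F / s%:F.
Proof.
by exists \n_(repr u), \d_(repr u); split;
  [apply: denom_ratioP | apply: ratfun_numden].
Qed.

Fact laurent_of_ratfun_is_zmod_morphism : zmod_morphism laurent_of_ratfun.
Proof.
move=> u v; have [p [s [s0 ->]]] := ratfunP u.
have [p' [s' [s'0 ->]]] := ratfunP v.
rewrite -mulNr addf_div ?tofrac_eq0 // -tofracN -!tofracM -tofracD.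
rewrite !laurent_of_ratfun_div ?mulf_neq0 // -mulNr.
by rewrite addf_div ?laurent_of_poly_eq0 // -rmorphN -!rmorphM -rmorphD.
Qed.

Fact laurent_of_ratfun_is_monoid_morphism : monoid_morphism laurent_of_ratfun.
Proof.
split=> [|u v].
  have := @laurent_of_ratfun_div 1 1 (oner_neq0 _).
  by rewrite !rmorph1 !divr1.
have [p [s [s0 ->]]] := ratfunP u.
have [p' [s' [s'0 ->]]] := ratfunP v.
rewrite mulf_div -!tofracM !laurent_of_ratfun_div ?mulf_neq0 //.
by rewrite mulf_div -!rmorphM.
Qed.

HB.instance Definition _ := GRing.isZmodMorphism.Build (ratfun F) (laurent F)
  laurent_of_ratfun laurent_of_ratfun_is_zmod_morphism.
HB.instance Definition _ := GRing.isMonoidMorphism.Build (ratfun F) (laurent F)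
  laurent_of_ratfun laurent_of_ratfun_is_monoid_morphism.

End RatfunLaurent.

Section SimpleExtension.
Variables (K L : fieldType) (iota : K -> L).

Definition adjoin (z : L) : L -> Prop := fun u =>
  forall S : {pred L}, GRing.divring_closed S ->
    (forall a, iota a \in S) -> z \in S -> u \in S.

Definition is_basis (E : L -> Prop) (d : nat) (b : 'I_d -> L) : Prop :=
  (forall i, E (b i)) /\
  (forall u, E u ->
     exists! c : {ffun 'I_d -> K}, u = \sum_(i < d) iota (c i) * b i).

(* [K(z) : K] = d *)
Definition has_degree (z : L) (d : nat) : Prop :=
  exists b : 'I_d -> L, is_basis (adjoin z) b.

End SimpleExtension.

Section AlgebraicSeries.
Variable F : fieldType.

Definition laurent_of_fps (f : {fps F}) : laurent F := FracField.tofrac f.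

Definition fps_algebraic (f : {fps F}) : Prop :=
  algebraicOver (@laurent_of_ratfun F) (laurent_of_fps f).

Definition fps_degree (f : {fps F}) (d : nat) : Prop :=
  has_degree (@laurent_of_ratfun F) (laurent_of_fps f) d.

(* A polynomial in F[x,y] is a P : {poly {poly F}} with outer variable y and
   coefficients in F[x]. *)
Definition degx (P : {poly {poly F}}) : nat :=
  \max_(j < size P) (size (P`_j)%R).-1.

(* P(x, f(x)) = 0 *)
Definition annihilates (P : {poly {poly F}}) (f : {fps F}) : Prop :=
  (map_poly (@fps_of_poly F) P).[f] = 0.

Definition fps_height (f : {fps F}) (h : nat) : Prop :=
  (exists P, [/\ P != 0, annihilates P f & degx P = h]) /\
  (forall P, P != 0 -> annihilates P f -> (h <= degx P)%N).

End AlgebraicSeries.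

Record dfao (q : nat) (A : Type) := DFAO {
  state : finType;
  init : state;
  step : state -> 'I_q -> state;
  output : state -> A
}.

Definition run q A (M : dfao q A) (w : seq 'I_q) : A :=
  output (foldl (@step q A M) (init M) w).

Fixpoint value q (w : seq 'I_q) : nat :=
  if w is i :: w' then (i + q * value w')%N else 0%N.

(* Every expansion of n is read from its least significant digit, including
   those padded with zeros on the most significant side. With this convention
   the size of a minimal automaton is the cardinality of the q-kernel; if only
   the canonical expansions were constrained, it could be smaller. *)
Definition generates q A (M : dfao q A) (a : nat -> A) : Prop :=
  forall w : seq 'I_q, run M w = a (value w).

(* c = comp_q(a); in particular, a is q-automatic. *)
Definition is_comp q A (a : nat -> A) (c : nat) : Prop :=
  (exists M : dfao q A, generates M a /\ #|state M| = c) /\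
  (forall M : dfao q A, generates M a -> (c <= #|state M|)%N).

(* Main.v *)
(* Let A be an annihilator of f that is minimal in y-degree and then in
   x-degree. By Gauss's lemma deg_x A <= h; moreover deg_y A <= d, and
   D = A'(f) is nonzero (the derivative being taken in y) because algebraic
   power series are separable over F_q(x). Consider the series of the form
   G(x, f) / D with
   deg_y G < d and deg_x G <= h: there are at most q^((h + 1) d) of them. One of
   them is f, with G = y A' - d A. They are stable under the Cartier operators
   \Lambda_j, which map (a_n) to (a_(q n + j)): indeed
   D \Lambda_j(G(f) / D) = \Lambda_j(G(f) D^(q - 1)), and G(f) D^(q - 1) is the
   coefficient of t^(q - 1) in (G A^(q - 1))(f + t). On H(f + t), taking this
   coefficient and then \Lambda_j amounts to applying to H the Cartier operator
   in the two variables x, y and evaluating at y = f, as one checks on the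
   monomials c(x) y^b; and that operator divides the degrees of G A^(q - 1) by q.
   Hence q^((h + 1) d) states suffice. *)
Require Import Defs.
From HB Require Import structures.
From mathcomp Require Import all_boot all_order all_algebra all_field.
From mathcomp Require Import polyXY fraction boolp reals ring.

Set Implicit Arguments.
Unset Strict Implicit.
Unset Printing Implicit Defensive.

Import Order.TTheory GRing.Theory Num.Theory.
Local Open Scope ring_scope.

Lemma sum_residue (V : nmodType) (m N r : nat) (G : nat -> V) : (r < m)%N ->
  \sum_(b < m * N | (b %% m == r)%N) G b = \sum_(e < N) G (m * e + r)%N.
Proof.
move=> lt_rm; rewrite -(big_mkord (fun b => b %% m == r)%N) -(big_mkord xpredT
  (fun e => G (m * e + r)%N)).
elim: N => [|N IHN]; first by rewrite muln0 !big_geq.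
rewrite big_nat_recr //= -IHN mulnS addnC.
rewrite (@big_cat_nat _ _ _ (m * N)) ?leq_addr //=; congr (_ + _).
rewrite -{1}[(m * N)%N]add0n big_addn addKn big_mkord (bigD1 (Ordinal lt_rm)) /=.
  rewrite addnC big1 ?addr0 // => i /andP[/eqP e_ir].
  case/eqP; apply: val_inj; rewrite /= -e_ir addnC mulnC modnMDl.
  by rewrite modn_small.
by rewrite addnC mulnC modnMDl modn_small.
Qed.

(** * Cartier operators on power series and polynomials over a finite field *)

Section Cartier.
Variables (F : finFieldType) (p k : nat).
Hypotheses (p_pr : prime p) (k_gt0 : (0 < k)%N) (cardF : #|F| = (p ^ k)%N).
Local Notation q := (p ^ k)%N.

Definition cartier (j : nat) (g : {fps F}) : {fps F} :=
  Fps (fun n => coefs g (j + q * n)%N).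

Definition poly_cartier (j : nat) (u : {poly F}) : {poly F} :=
  \poly_(i < size u) u`_(j + q * i).

Lemma q_gt1 : (1 < q)%N.
Proof. by rewrite -(exp1n k) ltn_exp2r ?prime_gt1. Qed.

Let q_gt0 : (0 < q)%N. Proof. exact: ltnW q_gt1. Qed.

Lemma pcharF : p \in [pchar F].
Proof. exact: card_finPcharP cardF p_pr. Qed.

Lemma pchar_nat_card (R : comNzRingType) (phi : {rmorphism F -> R}) :
  [pchar R].-nat q.
Proof.
rewrite pnatX; apply/orP; left; apply/pnatP => // [|r r_pr].
  exact: prime_gt0.
rewrite dvdn_prime2 // => /eqP ->; exact: rmorph_pchar phi _ pcharF.
Qed.

(** Raising to the power q is additive in characteristic p, and [c ^+ q = c] for every constant of
    [F]. *)
Lemma polyXq (u : {poly F}) : u ^+ q = u \Po 'X^q.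
Proof.
elim/poly_ind: u => [|u c IHu]; first by rewrite comp_poly0 expr0n gtn_eqF.
rewrite exprDn_pchar ?(pchar_nat_card (@polyC F)) // exprMn IHu -rmorphXn /=.
by rewrite -cardF expf_card comp_polyD comp_polyM comp_polyX comp_polyC.
Qed.

Lemma fps_exprDq (g r : {fps F}) : (g + r) ^+ q = g ^+ q + r ^+ q.
Proof.
by rewrite exprDn_pchar // (pchar_nat_card (@fps_of_poly F \o polyC)).
Qed.

(** Split g into its truncation [u], to which [polyXq] applies, and a rest [r] of order above n,
    whose q-th power does not reach index n. *)
Lemma coefs_expq (g : {fps F}) n :
  coefs (g ^+ q) n = if (q %| n)%N then coefs g (n %/ q) else 0.
Proof.
set u := fps_trunc n g; pose r := g - fps_of_poly u.
have r0 i : (i <= n)%N -> coefs r i = 0.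
  by move=> le_in; rewrite coefsD coefsN /= coef_fps_trunc ?subrr.
have -> : g = fps_of_poly u + r by rewrite addrC subrK.
rewrite fps_exprDq coefsD -rmorphXn polyXq /= coef_comp_poly_Xn //.
have -> : r ^+ q = r * r ^+ q.-1 by rewrite -exprS prednK.
rewrite coefsM big1 ?addr0 => [|i _]; last by rewrite r0 ?mul0r // -ltnS.
by case: ifP => // _; rewrite [X in _ + X]r0 ?addr0 // leq_div.
Qed.

(** By [coefs_expq], g^q is a series in x^q, so only the indices divisible by q survive in the
    convolution. *)
Lemma cartierMq j (c g : {fps F}) : (j < q)%N ->
  cartier j (c * g ^+ q) = cartier j c * g.
Proof.
move=> lt_jq; apply: fpsP => n.
rewrite mulrC [cartier j c * g]mulrC [LHS]coefsM [RHS]coefsM.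
rewrite (bigID (fun i : 'I__ => (q %| i)%N)) /= [X in _ + X]big1 ?addr0.
  have le_qm (m : nat) : (m < n.+1)%N -> (q * m < (j + q * n).+1)%N.
    by move=> le_mn; rewrite ltnS (leq_trans _ (leq_addl _ _)) // leq_mul2l
      -ltnS le_mn orbT.
  rewrite (reindex_onto (fun m : 'I_n.+1 => inord (q * m) : 'I_(j + q * n).+1)
    (fun i => inord (i %/ q))) /=; last first.
    move=> i q_i; have lt_iq : (i %/ q < n.+1)%N.
      rewrite ltn_divLR // (leq_trans (ltn_ord i)) // mulSn mulnC.
      by rewrite -addSn leq_add2r.
    by apply: val_inj; rewrite /= !inordK // mulnC divnK.
  apply: eq_big => [m|m _].
    rewrite inordK ?le_qm // dvdn_mulr //= mulKn //.
    by apply/eqP/val_inj; rewrite /= inordK.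
  rewrite inordK ?le_qm // coefs_expq dvdn_mulr // mulKn //.
  congr (_ * coefs c _).
  by rewrite mulnBr addnBA // leq_mul2l -ltnS ltn_ord orbT.
by move=> i /negPf q_i; rewrite coefs_expq q_i mul0r.
Qed.


Lemma cartier_is_zmod_morphism j : zmod_morphism (cartier j).
Proof. by move=> u v; apply: fpsP. Qed.

HB.instance Definition _ j := GRing.isZmodMorphism.Build {fps F} {fps F}
  (cartier j) (cartier_is_zmod_morphism j).

Lemma cartier_poly j (u : {poly F}) :
  cartier j (fps_of_poly u) = fps_of_poly (poly_cartier j u).
Proof.
apply: fpsP => n; rewrite /= coef_poly; case: ltnP => // le_un.
rewrite nth_default // (leq_trans le_un) //.
by rewrite (leq_trans _ (leq_addl _ _)) ?leq_pmull.
Qed.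

(* Write b = q e + r with r < q; then (X + f)^b = (X^q + f^q)^e (X + f)^r. *)
Lemma coef_XDC_exp (f : {fps F}) (b : nat) :
  (('X + f%:P) ^+ b)`_q.-1 =
    if (b %% q == q.-1)%N then (f ^+ (b %/ q)) ^+ q else 0.
Proof.
have lt_rq : (b %% q < q)%N by rewrite ltn_mod.
rewrite {1}(divn_eq b q) exprD mulnC exprM.
rewrite exprDn_pchar; last first.
  by rewrite (pchar_nat_card (@polyC _ \o @fps_of_poly F \o @polyC F)).
(* Multiples of X^q times a polynomial do not reach the coefficient of X^(q - 1), so only the
   constant term of this power matters. *)
have [S ->] : exists S : {poly {fps F}}, ('X^q + f%:P ^+ q) ^+ (b %/ q) =
    ((f ^+ (b %/ q)) ^+ q)%:P + S * 'X^q.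
  elim: (b %/ q)%N => [|e [S IHS]].
    by exists 0; rewrite !expr0 mul0r addr0 expr1n.
  exists (('X^q + f%:P ^+ q) * S + ((f ^+ e) ^+ q)%:P).
  rewrite exprS IHS [f ^+ e.+1]exprS exprMn polyCM [(f ^+ q)%:P]polyC_exp.
  by move: (f%:P ^+ q) (polyC _) ('X^q) => u v w; ring.
rewrite mulrDl coefD coefCM mulrAC coefMXn ltn_predL q_gt0 addr0.
rewrite addrC exprDn coef_sum.
under eq_bigr => i _ do rewrite -rmorphXn coefMn coefCM coefXn.
case: eqP => [->|/eqP ne_r].
  by rewrite big_ord_recr /= eqxx binn subnn expr0 !mulr1 big1 ?add0r ?mulr1
    // => i _; rewrite gtn_eqF // mulr0 mul0rn.
rewrite big1 ?mulr0 // => i _; rewrite gtn_eqF ?mulr0 ?mul0rn //.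
rewrite (leq_ltn_trans (_ : (i <= b %% q)%N)) -1?ltnS //.
by rewrite prednK // ltn_neqAle lt_rq -(inj_eq succn_inj) prednK ?andbT in ne_r *.
Qed.

(** By [coef_XDC_exp] only the exponents b = q e + q - 1 contribute, each with a factor (f^e)^q that
    [cartierMq] takes out as f^e. *)
Lemma cartier_coef_taylor j (f : {fps F}) (H : {poly {fps F}}) : (j < q)%N ->
  cartier j (H \Po ('X + f%:P))`_q.-1 =
    \sum_(e < size H) cartier j H`_(q * e + q.-1) * f ^+ e.
Proof.
move=> lt_jq; rewrite comp_polyE coef_sum raddf_sum /=.
pose G b := cartier j H`_b * f ^+ (b %/ q).
transitivity (\sum_(b < q * size H | (b %% q == q.-1)%N) G b); last first.
  rewrite sum_residue ?ltn_predL //; apply: eq_bigr => e _.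
  by rewrite /G mulnC divnMDl // divn_small ?addn0 // ltn_predL.
rewrite -(big_mkord (fun b => (b %% q == q.-1)%N)).
rewrite (@big_cat_nat _ _ _ (size H)) ?leq_pmull //= [X in _ = _ + X]big_nat_cond.
rewrite [X in _ = _ + X]big1 ?addr0 => [|i /andP[/andP[le_Hi _] _]]; last first.
  by rewrite /G nth_default // raddf0 mul0r.
rewrite big_mkord [RHS]big_mkcond /=; apply: eq_bigr => b _.
rewrite coefZ coef_XDC_exp; case: ifP => _; last by rewrite mulr0 raddf0.
by rewrite cartierMq.
Qed.

(** If A = B (y - f), then A(f + t) = B(f + t) t and A'(f) = B(f), so the coefficient of t^n is G(f)
    B(f)^n. *)
Lemma coef_taylor_root (f : {fps F}) (A G : {poly {fps F}}) n : root A f ->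
  ((G * A ^+ n) \Po ('X + f%:P))`_n = G.[f] * (A^`()).[f] ^+ n.
Proof.
case/factor_theorem => B ->.
have -> : (B * ('X - f%:P))^`().[f] = B.[f].
  rewrite derivM derivXsubC mulr1 hornerD hornerM hornerXsubC.
  by rewrite subrr mulr0 add0r.
rewrite exprMn mulrA rmorphM /= [(('X - _) ^+ n) \Po _]rmorphXn /=.
rewrite comp_polyB comp_polyX comp_polyC addrK coefMXn ltnn subnn.
rewrite -horner_coef0 horner_comp hornerD hornerX hornerC add0r.
by rewrite hornerM horner_exp.
Qed.

(* The Cartier operator in two variables, sending x^(q a + j) y^(q e + q - 1) to
   x^a y^e and every other monomial to 0. *)
Definition cartier2 j (H : {poly {poly F}}) : {poly {poly F}} :=
  \poly_(e < size H) poly_cartier j H`_(q * e + q.-1).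

Local Notation "A ^:f" := (map_poly (@fps_of_poly F) A) (at level 2).

Lemma horner_cartier2 j (H : {poly {poly F}}) (f : {fps F}) : (j < q)%N ->
  (cartier2 j H)^:f.[f] = cartier j ((H^:f \Po ('X + f%:P))`_q.-1).
Proof.
move=> lt_jq; rewrite cartier_coef_taylor //.
rewrite size_map_inj_poly ?rmorph0 //; last exact: fps_of_poly_inj.
rewrite (@horner_coef_wide _ (size H)).
  apply: eq_bigr => e _; rewrite !coef_map /= cartier_poly.
  by rewrite coef_poly ltn_ord.
by rewrite (leq_trans (size_poly _ _)) // size_poly.
Qed.

Lemma cartier_quotient j (A G : {poly {poly F}}) (f g : {fps F}) : (j < q)%N ->
  annihilates A f -> (A^`())^:f.[f] * g = G^:f.[f] ->
  (A^`())^:f.[f] * cartier j g = (cartier2 j (G * A ^+ q.-1))^:f.[f].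
Proof.
move=> lt_jq A0 DgG; rewrite horner_cartier2 // rmorphM rmorphXn /=.
rewrite coef_taylor_root; last exact/rootP.
rewrite deriv_map -DgG -mulrA mulrCA -exprS prednK //.
by rewrite [RHS]cartierMq // mulrC.
Qed.

End Cartier.

(** * Degree in x, Gauss's lemma and minimal annihilators *)

Section Height.
Variable F : fieldType.
Implicit Types (A B P : {poly {poly F}}) (c u : {poly F}).

(** Exchanging x and y makes [degx] an ordinary degree, whence its additivity on products. *)
Lemma degxE P : degx P = (sizeY P).-1.
Proof.
apply/eqP; rewrite eqn_leq; apply/andP; split.
  apply/bigmax_leqP => i _; rewrite -!subn1 leq_sub2r //.
  exact: max_size_coefXY.
rewrite -subn1 leq_subLR add1n; apply/bigmax_leqP => i _.
apply: (leq_trans (leqSpred _)); rewrite ltnS /degx.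
exact: (@leq_bigmax _ (fun j : 'I_(size P) => (size P`_j).-1)).
Qed.

Lemma degx_leP P n :
  reflect (forall i, (size (P`_i)%R <= n.+1)%N) (degx P <= n)%N.
Proof.
rewrite degxE -subn1 leq_subLR add1n; apply: (iffP idP) => [le_n i | le_n].
  by rewrite (leq_trans (max_size_coefXY _ _)).
by apply/bigmax_leqP.
Qed.

Lemma degx_mul A B : A != 0 -> B != 0 -> degx (A * B) = (degx A + degx B)%N.
Proof.
move=> A0 B0; rewrite !degxE !sizeYE rmorphM /= size_mul ?swapXY_eq0 //.
rewrite -swapXY_eq0 -size_poly_gt0 in A0.
rewrite -swapXY_eq0 -size_poly_gt0 in B0.
by rewrite -(prednK A0) -(prednK B0) addnS.
Qed.

Lemma degx_mul_leq A B : (degx (A * B) <= degx A + degx B)%N.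
Proof.
have degx0 : degx (0 : {poly {poly F}}) = 0%N.
  by rewrite /degx big1 // => i _; rewrite coef0 size_poly0.
have [->|A0] := eqVneq A 0; first by rewrite mul0r degx0.
have [->|B0] := eqVneq B 0; first by rewrite mulr0 degx0.
by rewrite degx_mul.
Qed.

Lemma degx_exp_leq A n : (degx (A ^+ n) <= n * degx A)%N.
Proof.
elim: n => [|n IHn].
  by apply/degx_leP => i; rewrite expr0 coef1; case: eqP;
    rewrite ?size_poly1 ?size_poly0.
rewrite exprS mulSn (leq_trans (degx_mul_leq _ _)) //.
by rewrite leq_add2l.
Qed.

Lemma degxC c : degx c%:P = (size c).-1.
Proof. by rewrite degxE sizeYE swapXY_polyC size_map_polyC. Qed.

Lemma irreducible_divisor c : (1 < size c)%N ->
  exists2 u, irreducible_poly u & u %| c.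
Proof.
move=> c_gt1; pose D n := `[< exists u, [/\ size u = n, (1 < n)%N & u %| c] >].
have exD : exists n, D n by exists (size c); apply/asboolP; exists c.
have c0 : c != 0 by rewrite -size_poly_gt0 ltnW.
case: (ex_minnP exD) => n /asboolP[u [<- u_gt1 u_c]] min_u; exists u => //.
split=> // v v1 v_u; have v_c := dvdp_trans v_u u_c.
rewrite -dvdp_size_eqp // eqn_leq; apply/andP; split.
  by rewrite dvdp_leq // -size_poly_gt0 ltnW.
apply: min_u; apply/asboolP; exists v; split=> //.
by rewrite ltn_neqAle eq_sym v1 size_poly_gt0 (dvdpN0 v_c).
Qed.

(** If z is a root of both, it is a root of their gcd, which is then a nonconstant divisor of u and
    so an associate of u. *)
Lemma irreducible_dvd_root (L : fieldExtType F) u v (z : L) :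
    irreducible_poly u -> root (map_poly (in_alg L) u) z ->
  root (map_poly (in_alg L) v) z = (u %| v).
Proof.
move=> [u_gt1 irr_u] uz; apply/idP/idP => [vz | u_v]; last first.
  by case/dvdpP: u_v => w ->; rewrite rmorphM rootM uz orbT.
have gcd_z : root (map_poly (in_alg L) (gcdp u v)) z.
  by rewrite gcdp_map root_gcd uz vz.
have gcd1 : size (gcdp u v) != 1%N.
  apply/eqP => /eqP/size_poly1P[a a0 gcd_a]; move: gcd_z.
  by rewrite gcd_a map_polyC rootC /= scaler_eq0 oner_eq0 orbF (negPf a0).
by rewrite -(eqp_dvdl _ (irr_u _ gcd1 (dvdp_gcdl _ _))) dvdp_gcdr.
Qed.

(* Gauss's lemma: F[x]/(u) embeds into a field L, and L[y] is a domain. *)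
Lemma irreducible_dvd_coef_mul u A B : irreducible_poly u ->
    (forall i, u %| (A * B)`_i) ->
  (forall i, u %| A`_i) \/ (forall i, u %| B`_i).
Proof.
move=> irr_u u_AB; have [L _ [z uz _]] := irredp_FAdjoin irr_u.
pose ev := horner_eval z \o map_poly (in_alg L).
have evP v : (ev v == 0) = (u %| v) by apply: irreducible_dvd_root.
have /eqP : map_poly ev (A * B) = 0.
  by apply/polyP => i; rewrite coef_map coef0; apply/eqP; rewrite evP.
rewrite rmorphM mulf_eq0 => /orP[]/eqP/polyP ev0; [left|right] => i;
  by move/eqP: (ev0 i); rewrite coef_map coef0 evP.
Qed.

Lemma dvd_coefP u A : (forall i, u %| A`_i) -> exists B, A = u *: B.
Proof.
move=> u_A; exists (map_poly (fun a => a %/ u) A); apply/polyP => i.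
by rewrite coefZ coef_map_id0 ?div0p // mulrC divpK.
Qed.

Lemma annihilatesZ c A f : c != 0 ->
  annihilates (c *: A) f <-> annihilates A f.
Proof.
move=> c0; rewrite /annihilates map_polyZ hornerZ; split=> [/eqP|->].
  rewrite mulf_eq0 raddf_eq0 ?(negPf c0) => [/eqP //|].
  exact: fps_of_poly_inj.
by rewrite mulr0.
Qed.

(** Take [A] minimal in y-degree, then in x-degree. Pseudo-division gives c P = A B with c in F[x];
    Gauss's lemma cancels the irreducible factors of c one at a time, until c is constant and
    x-degrees can be compared. *)
Lemma min_annihilator (f : {fps F}) P : P != 0 -> annihilates P f ->
  exists A, [/\ A != 0, annihilates A f, (degx A <= degx P)%N
    & forall B, B != 0 -> annihilates B f -> (size A <= size B)%N].
Proof.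
move=> P0 Pf.
pose S n := `[< exists A, [/\ A != 0, annihilates A f & size A = n] >].
have exS : exists n, S n by exists (size P); apply/asboolP; exists P.
case: (ex_minnP exS) => s /asboolP s_ann min_s.
pose X n := `[< exists A,
  [/\ A != 0, annihilates A f, size A = s & degx A = n] >].
have exX : exists n, X n.
  by case: s_ann => A [A0 Af sA]; exists (degx A); apply/asboolP; exists A.
case: (ex_minnP exX) => e /asboolP[A [A0 Af sA dA]] min_e.
have minA B : B != 0 -> annihilates B f -> (size A <= size B)%N.
  by move=> B0 Bf; rewrite sA; apply: min_s; apply/asboolP; exists B.
exists A; split => //.
pose c := lead_coef A ^+ scalp P A.
have c0 : c != 0 by rewrite expf_neq0 // lead_coef_eq0.
have eqP := Pdiv.Idomain.divp_eq P A.
have rem0 : P %% A = 0.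
  apply: contraTeq (ltn_modpN0 P A0) => rem0.
  rewrite -leqNgt; apply: minA => //.
  have -> : P %% A = c *: P - P %/ A * A by rewrite eqP addrC addKr.
  rewrite /annihilates rmorphB rmorphM hornerD hornerN hornerM.
  have /(annihilatesZ P f c0) -> := Pf.
  by rewrite [X in _ * X]Af mulr0 subrr.
have : exists c B, c != 0 /\ c *: P = A * B.
  by exists c, (P %/ A); split; rewrite // eqP rem0 addr0 mulrC.
case=> {c c0 eqP rem0} c [B []].
have [n] := ubnP (size c); elim: n c B => // n IHn c B /ltnSE-le_cn c0 eq_cP.
have [c_gt1 | c_le1] := ltnP 1 (size c); last first.
  have B0 : B != 0.
    apply: contraNneq c0 => B0; move/eqP: eq_cP.
    by rewrite B0 mulr0 -mul_polyC mulf_eq0 polyC_eq0 (negPf P0) orbF.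
  have := congr1 (@degx F) eq_cP; rewrite -mul_polyC !degx_mul ?polyC_eq0 //.
  have c1 : size c = 1%N by apply/eqP; rewrite eqn_leq c_le1 size_poly_gt0.
  by rewrite degxC c1 add0n => ->; apply: leq_addr.
have [u irr_u u_c] := irreducible_divisor c_gt1.
have u_gt1 := irr_u.1; have u0 : u != 0 by rewrite -size_poly_gt0 ltnW.
have u_AB i : u %| (A * B)`_i by rewrite -eq_cP coefZ dvdp_mulr.
(* If u divided [A], the quotient would be an annihilator of the same y-degree and smaller x-degree.
   So u divides [B] and cancels against c. *)
have [] := irreducible_dvd_coef_mul irr_u u_AB => /dvd_coefP[C eqC].
  have C0 : C != 0 by apply: contraNneq A0 => C0; rewrite eqC C0 scaler0.
  have sC : size C = s by rewrite -sA eqC size_scale.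
  have Cf : annihilates C f by apply/(annihilatesZ _ _ u0); rewrite -eqC.
  have : (e <= degx C)%N by apply: min_e; apply/asboolP; exists C.
  rewrite -dA eqC -mul_polyC degx_mul ?polyC_eq0 // degxC.
  by case: (size u) u_gt1 => [|[|m]] //= _; rewrite addSn ltnNge leq_addl.
move: u_c c0 le_cn eq_cP => /dvdpP[c' ->].
rewrite mulf_eq0 negb_or => /andP[c'0 _].
rewrite size_mul // eqC => le_n.
have uP0 : u%:P != 0 by rewrite polyC_eq0.
rewrite mulrC -scalerA -scalerAr -[LHS]mul_polyC -[RHS]mul_polyC.
move=> /(mulfI uP0); apply: IHn c'0.
apply: leq_trans le_n.
by case: (size u) u_gt1 => [|[|m]] // _; rewrite !addnS /= ltnS leq_addr.
Qed.

End Height.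

(** * From the degree of f to an annihilator of bounded degree in y *)

Section Degree.
Variable F : fieldType.
Local Notation "x %:F" := (FracField.tofrac x).

Lemma adjoin_exp (K L : fieldType) (iota : K -> L) (z : L) n :
  adjoin iota z (z ^+ n).
Proof.
move=> S S_div _ zS; have [one_S _ div_S] := S_div.
have [_ mul_S] := GRing.divr_closedM (conj one_S div_S).
by elim: n => [|n IHn]; rewrite ?expr0 // exprS; apply: mul_S.
Qed.

Lemma laurent_of_ratfun_poly (u : {poly F}) :
  laurent_of_ratfun u%:F = laurent_of_poly u.
Proof.
rewrite -[u%:F]divr1 -(rmorph1 (@FracField.tofrac {poly F})).
by rewrite laurent_of_ratfun_div ?oner_eq0 // rmorph1 divr1.
Qed.

Lemma common_denominator (n : nat) (v : 'I_n -> ratfun F) :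
  exists s : {poly F}, s != 0 /\
    exists a : 'I_n -> {poly F}, forall i, v i * s%:F = (a i)%:F.
Proof.
exists (\prod_i \d_(repr (v i))); split.
  by apply/prodf_neq0 => i _; apply: denom_ratioP.
exists (fun i => \n_(repr (v i)) * \prod_(j | j != i) \d_(repr (v j))) => i.
rewrite {1}[v i]ratfun_numden (bigD1 i) //= !rmorphM /= mulrA divfK //.
by rewrite tofrac_eq0 denom_ratioP.
Qed.

(** The d + 1 powers z^0, ..., z^d have coordinates in a space of dimension d, hence a nontrivial
    linear relation over F(x); it remains to clear denominators. *)
Lemma degree_annihilator (f : {fps F}) d : fps_degree f d ->
  exists P, [/\ P != 0, annihilates P f & (size P <= d.+1)%N].
Proof.
case=> b [_ b_basis]; set z := laurent_of_fps f in b_basis.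
have /choice[c c_z] (i : 'I_d.+1) : exists c : {ffun 'I_d -> ratfun F},
    z ^+ i = \sum_(j < d) laurent_of_ratfun (c j) * b j.
  by have [c [eq_c _]] := b_basis _ (@adjoin_exp _ _ _ z i); exists c.
pose M := \matrix_(i < d.+1, j < d) c i j.
pose v := nz_row (kermx M).
have v0 : v != 0.
  rewrite nz_row_eq0 -mxrank_eq0 mxrank_ker subn_eq0 -ltnNge ltnS.
  exact: rank_leq_col.
have vM : v *m M = 0 by apply/sub_kermxP; apply: nz_row_sub.
have [s [s0 [a eq_a]]] := common_denominator (v 0).
have a_z : \sum_(i < d.+1) laurent_of_poly (a i) * z ^+ i = 0.
  under eq_bigr => i _ do rewrite -laurent_of_ratfun_poly -eq_a c_z mulr_sumr.
  rewrite exchange_big big1 //= => j _.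
  have /rowP/(_ j) := vM; rewrite !mxE => vMj.
  transitivity (laurent_of_ratfun ((\sum_i v 0 i * M i j) * s%:F) * b j).
    rewrite mulr_suml rmorph_sum mulr_suml; apply: eq_bigr => i _.
    by rewrite [M i j]mxE (mulrAC (v 0 i)) (rmorphM _ (v 0 i * _)) mulrA.
  by rewrite vMj mul0r rmorph0 mul0r.
pose P := \poly_(i < d.+1) a (inord i).
have coefP (i : 'I_d.+1) : P`_i = a i by rewrite coef_poly ltn_ord inord_val.
exists P; split; last exact: size_poly.
  apply: contraNneq v0 => P0; apply/eqP/rowP => i; rewrite mxE.
  have : v 0 i * s%:F = 0 by rewrite eq_a -coefP P0 coef0 rmorph0.
  by move/eqP; rewrite mulf_eq0 tofrac_eq0 (negPf s0) orbF => /eqP.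
apply/eqP; rewrite -tofrac_eq0 (@horner_coef_wide _ d.+1); last first.
  by rewrite (leq_trans (size_poly _ _)) // size_poly.
rewrite rmorph_sum -[X in _ == X]a_z; apply/eqP/eq_bigr => i _.
by rewrite rmorphM rmorphXn /= coef_map coefP.
Qed.

End Degree.

(** * Separability and the automaton of Cartier operators *)

Section Automaton.
Variables (F : finFieldType) (p k : nat).
Hypotheses (p_pr : prime p) (k_gt0 : (0 < k)%N) (cardF : #|F| = (p ^ k)%N).
Local Notation q := (p ^ k)%N.
Local Notation "A ^:f" := (map_poly (@fps_of_poly F) A) (at level 2).

Let q_gt0 : (0 < q)%N. Proof. by rewrite expn_gt0 prime_gt0. Qed.

Lemma poly_cartier0 j : poly_cartier p k j (0 : {poly F}) = 0.
Proof. by rewrite /poly_cartier poly_def size_poly0 big_ord0. Qed.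

Lemma size_poly_cartier j (u : {poly F}) h : (size u <= (q * h).+1)%N ->
  (size (poly_cartier p k j u) <= h.+1)%N.
Proof.
move=> le_u; apply/leq_sizeP => i lt_hi; rewrite coef_poly.
case: ifP => // _; apply/nth_default/(leq_trans le_u).
apply: leq_trans (leq_addl _ _); apply: leq_trans (_ : q * h.+1 <= _)%N.
  by rewrite mulnS -add1n leq_add2r.
by rewrite leq_mul2l lt_hi orbT.
Qed.

Lemma size_cartier2 j (H : {poly {poly F}}) d : (size H <= q * d)%N ->
  (size (cartier2 p k j H) <= d)%N.
Proof.
move=> le_H; apply/leq_sizeP => i le_di; rewrite coef_poly.
case: ifP => // _; rewrite nth_default ?poly_cartier0 // (leq_trans le_H) //.
by rewrite (leq_trans _ (leq_addr _ _)) // leq_mul2l le_di orbT.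
Qed.

Lemma degx_cartier2 j (H : {poly {poly F}}) h : (degx H <= q * h)%N ->
  (degx (cartier2 p k j H) <= h)%N.
Proof.
move=> /degx_leP le_H; apply/degx_leP => i; rewrite coef_poly.
by case: ifP => _; rewrite ?size_poly0 ?size_poly_cartier.
Qed.

(* If A' = 0, then A = \sum_i a_i(x) y^(p i), and applying the Cartier operators
   to A(x, f)^(q / p) = \sum_i a_i(x)^(q / p) (f^i)^q yields annihilators of f of
   smaller degree in y, one of which is nonzero. *)
Lemma min_annihilator_separable (f : {fps F}) (A : {poly {poly F}}) :
    A != 0 -> annihilates A f ->
    (forall B, B != 0 -> annihilates B f -> (size A <= size B)%N) ->
  (A^`())^:f.[f] != 0.
Proof.
move=> A0 Af minA; apply/eqP => dAf.
have min0 (B : {poly {poly F}}) :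
    (size B < size A)%N -> annihilates B f -> B = 0.
  by move=> lt_BA Bf; apply: contraTeq lt_BA => B0; rewrite -leqNgt minA.
(* The derivative annihilates f and is shorter than [A], so it vanishes by minimality. *)
have /polyP dA0 : A^`() = 0 by apply: min0 dAf; apply: lt_size_deriv.
have A_p i : ~~ (p %| i)%N -> A`_i = 0.
  case: i => [|i] p_i; first by rewrite dvdn0 in p_i.
  have := dA0 i; rewrite coef_deriv coef0 -mulr_natr => /eqP.
  rewrite mulf_eq0 => /orP[/eqP // |].
  have pcharP : p \in [pchar {poly F}] by rewrite pchar_poly (pcharF p_pr cardF).
  by rewrite -(dvdn_pcharf pcharP) (negPf p_i).
have A_gt1 : (1 < size A)%N.
  rewrite ltnNge; apply: contraNN A0 => /size1_polyC eqA; move: Af.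
  rewrite eqA /annihilates map_polyC hornerC /= => /eqP.
  by rewrite raddf_eq0 ?polyC_eq0 //; apply: fps_of_poly_inj.
pose m := (p ^ k.-1)%N; have pm : (p * m)%N = q by rewrite -expnS prednK.
have m_gt0 : (0 < m)%N by rewrite expn_gt0 prime_gt0.
have char_m : [pchar {fps F}].-nat m.
  have := pchar_nat_card p_pr cardF (@fps_of_poly F \o polyC).
  by rewrite -pm pnatM => /andP[].
pose B j := \poly_(i < size A) poly_cartier p k j (A`_(p * i) ^+ m).
have Bf j : (j < q)%N -> annihilates (B j) f.
  move=> lt_jq; rewrite /annihilates (@horner_coef_wide _ (size A)); last first.
    by rewrite (leq_trans (size_poly _ _)) // size_poly.
  transitivity (cartier p k j ((A^:f.[f]) ^+ m)); last first.
    by rewrite Af expr0n gtn_eqF // raddf0.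
  rewrite [in RHS](@horner_coef_wide _ (p * size A)); last first.
    by rewrite (leq_trans (size_poly _ _)) // leq_pmull // prime_gt0.
  rewrite [in RHS](bigID (fun i : 'I__ => (i %% p == 0)%N)) /=.
  rewrite [X in _ + X]big1 ?addr0 => [|i /A_p Ai]; last first.
    by rewrite coef_map /= Ai rmorph0 mul0r.
  rewrite (sum_residue (size A) (fun i => A^:f`_i * f ^+ i)) ?prime_gt0 //.
  rewrite (big_morph (fun x : {fps F} => x ^+ m)
    (fun x y => exprDn_pchar x y char_m) (expr0n _ _)).
  rewrite gtn_eqF // raddf_sum; apply: eq_bigr => i _.
  rewrite /= addn0 exprMn -exprM mulnAC pm (mulnC q) exprM.
  rewrite (cartierMq p_pr k_gt0 cardF) // !coef_map /= coef_poly ltn_ord.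
  by rewrite -rmorphXn cartier_poly.
have B0 j : (j < q)%N -> B j = 0.
  move=> lt_jq; apply: min0 (Bf j lt_jq).
  (* Since p >= 2 and deg_y A >= 1, any i >= deg_y A satisfies p i > deg_y A, where [A] has no
     coefficient. *)
  rewrite -(ltn_predK A_gt1) ltnS; apply/leq_sizeP => i le_Ai.
  rewrite coef_poly; case: ifP => // _; rewrite nth_default.
    by rewrite expr0n gtn_eqF // poly_cartier0.
  apply: leq_trans (_ : 2 * i <= _)%N; last by rewrite leq_mul2r prime_gt1 ?orbT.
  apply: leq_trans (_ : 2 * (size A).-1 <= _)%N; last by rewrite leq_mul2l.
  case: (size A) A_gt1 => [|[|s]] // _.
  by rewrite /= mul2n -addnn addSnnS leq_addl.
move/eqP: A0; apply; apply/polyP => i; rewrite coef0.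
have [/dvdnP[e ->] | /A_p //] := boolP (p %| i)%N.
have [le_Ae | lt_eA] := leqP (size A) e.
  by rewrite nth_default // (leq_trans le_Ae) // leq_pmulr // prime_gt0.
rewrite mulnC; suff /eqP : A`_(p * e) ^+ m = 0.
  by rewrite expf_eq0 => /andP[_ /eqP].
(* The coefficient of index n appears in [B j] for j = n mod q, at index n / q of its e-th
   coefficient. *)
apply/polyP => n; rewrite coef0 (divn_eq n q) addnC [(n %/ q * q)%N]mulnC.
have lt_nq : (n %% q < q)%N by rewrite ltn_mod.
have /polyP/(_ e) := B0 _ lt_nq; rewrite coef_poly lt_eA coef0.
move/(congr1 (@fps_of_poly F)); rewrite -cartier_poly // rmorph0.
by move/(congr1 (fun g => coefs g (n %/ q))).
Qed.

Section Construction.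
Variables (f : {fps F}) (A : {poly {poly F}}) (d h : nat).
Hypotheses (Af : annihilates A f) (A_sep : (A^`())^:f.[f] != 0).
Hypotheses (sA : (size A <= d.+1)%N) (dA : (degx A <= h)%N).

(** Matrices serve as states because they form a finite type of known cardinality; row b holds the
    coefficients in x of y^b. *)
Definition poly2_of_mx (M : 'M[F]_(d, h.+1)) : {poly {poly F}} :=
  rVpoly (\row_b rVpoly (row b M)).

Definition mx_of_poly2 (G : {poly {poly F}}) : 'M[F]_(d, h.+1) :=
  \matrix_(b < d) poly_rV G`_b.

Lemma mx_of_poly2K (G : {poly {poly F}}) :
  (size G <= d)%N -> (degx G <= h)%N -> poly2_of_mx (mx_of_poly2 G) = G.
Proof.
move=> sG /degx_leP dG; rewrite -[RHS](poly_rV_K sG); congr rVpoly.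
by apply/rowP => b; rewrite !mxE rowK poly_rV_K.
Qed.

Lemma size_poly2_of_mx (M : 'M[F]_(d, h.+1)) : (size (poly2_of_mx M) <= d)%N.
Proof. exact: size_poly. Qed.

Lemma degx_poly2_of_mx (M : 'M[F]_(d, h.+1)) : (degx (poly2_of_mx M) <= h)%N.
Proof.
apply/degx_leP => i; rewrite coef_rVpoly; case: insubP => [b _ _ | _].
  by rewrite mxE size_poly.
by rewrite size_poly0.
Qed.

Definition christol_step (M : 'M[F]_(d, h.+1)) (i : 'I_q) :=
  mx_of_poly2 (cartier2 p k i (poly2_of_mx M * A ^+ q.-1)).

(* The value at 0 of the series G(x, f) / A'(f), where G is the polynomial of the
   state; the default 0 is never used in states reachable from
   [christol_init]. *)
Definition christol_output (M : 'M[F]_(d, h.+1)) : F :=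
  if pselect (exists g, (A^`())^:f.[f] * g = (poly2_of_mx M)^:f.[f])
    is left ex_g then coefs (projT1 (cid ex_g)) 0 else 0.

(* This polynomial has degree less than d in y, since the terms in y^d cancel,
   and its value at y = f is A'(f) f. *)
Definition christol_init := mx_of_poly2 (A^`() * 'X - A *+ d).

Definition christol_dfao : dfao q F :=
  DFAO christol_init christol_step christol_output.

Lemma christol_initP :
  (A^`())^:f.[f] * f = (poly2_of_mx christol_init)^:f.[f].
Proof.
have coefG i : (A^`() * 'X - A *+ d)`_i = A`_i *+ i - A`_i *+ d.
  rewrite coefB coefMX coefMn coef_deriv.
  by case: i => [|i]; rewrite ?mulr0n.
rewrite mx_of_poly2K.
- rewrite rmorphB rmorphM rmorphMn /= map_polyX hornerD hornerN hornerMn.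
  by rewrite Af mul0rn subr0 hornerMX.
- apply/leq_sizeP => i; rewrite coefG leq_eqVlt => /predU1P[<-|lt_di].
    by rewrite subrr.
  by rewrite nth_default ?(leq_trans sA) // !mul0rn subr0.
apply/degx_leP => i; rewrite coefG (leq_trans (size_polyD _ _)) // size_polyN.
move/degx_leP: dA => /(_ i) dAi.
by rewrite geq_max -!scaler_nat !(leq_trans (size_scale_leq _ _)).
Qed.

(** Nothing is lost in [mx_of_poly2]: G A^(q - 1) has x-degree at most h + (q - 1) h = q h and
    y-size at most d + (q - 1) d = q d, and [cartier2] divides these bounds by q. *)
Lemma christol_stepP M (g : {fps F}) (i : 'I_q) :
  (A^`())^:f.[f] * g = (poly2_of_mx M)^:f.[f] ->
  (A^`())^:f.[f] * cartier p k i g = (poly2_of_mx (christol_step M i))^:f.[f].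
Proof.
move=> Dg; rewrite (cartier_quotient p_pr k_gt0 cardF (ltn_ord i) Af Dg).
have eq_q n : (n + q.-1 * n)%N = (q * n)%N by rewrite -mulSn prednK.
rewrite mx_of_poly2K //; last first.
  apply: degx_cartier2; rewrite -eq_q (leq_trans (degx_mul_leq _ _)) //.
  rewrite leq_add ?degx_poly2_of_mx // (leq_trans (degx_exp_leq _ _)) //.
  by rewrite leq_mul2l dA orbT.
apply: size_cartier2; rewrite -eq_q.
rewrite (leq_trans (size_polyMleq _ _)) // -[(_ + _).-1]subn1 leq_subLR add1n.
rewrite -addnS leq_add ?size_poly2_of_mx //.
rewrite (leq_trans (size_poly_exp_leq _ _)) // ltnS mulnC leq_mul2l.
by rewrite -[(size A).-1]subn1 leq_subLR add1n sA orbT.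
Qed.

Lemma christol_dfao_generates : generates christol_dfao (coefs f).
Proof.
(* The induction runs over all states that represent a series; reading a digit i replaces g by its
   image under [cartier p k i]. *)
suff state_out w M g : (A^`())^:f.[f] * g = (poly2_of_mx M)^:f.[f] ->
    christol_output (foldl christol_step M w) = coefs g (value w).
  by move=> w; apply: state_out christol_initP.
elim: w M g => [|i w IHw] M g Dg /=; last first.
  by rewrite (IHw _ _ (christol_stepP i Dg)).
rewrite /christol_output; case: pselect => [ex_g|[]]; last by exists g.
(* As A'(f) is nonzero, the series chosen by [christol_output] is g itself. *)
by case: cid => g' /=; rewrite -Dg => /(mulfI A_sep) ->.
Qed.

Lemma card_christol_state : #|state christol_dfao| = (q ^ ((h + 1) * d))%N.
Proof. by rewrite card_mx cardF addn1 mulnC. Qed.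

End Construction.
End Automaton.

(** * Minimal automata and the final bound *)

Lemma ex_is_comp q A (a : nat -> A) (M : dfao q A) : generates M a ->
  exists c, is_comp q a c /\ (c <= #|state M|)%N.
Proof.
move=> M_a.
pose S n := `[< exists M' : dfao q A, generates M' a /\ #|state M'| = n >].
have exS : exists n, S n by exists #|state M|; apply/asboolP; exists M.
case: (ex_minnP exS) => c /asboolP c_a min_c; exists c; split; last first.
  by apply: min_c; apply/asboolP; exists M.
by split=> // M' M'_a; apply: min_c; apply/asboolP; exists M'.
Qed.

Theorem theorem4p1 (R : realType) :
  exists eps : nat -> nat -> nat -> R,
    (forall delta : R, 0 < delta ->
       exists N : nat, forall q h d : nat,
         [|| (N <= q)%N, (N <= h)%N | (N <= d)%N] -> `|eps q h d| < delta)
    /\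
    (forall (p k q : nat) (F : finFieldType) (f : {fps F}) (d h : nat),
       prime p -> (0 < k)%N -> q = (p ^ k)%N -> #|F| = q ->
       fps_algebraic f -> fps_degree f d -> fps_height f h ->
       exists c : nat, is_comp q (coefs f) c /\
         c%:R <= (1 + eps q h d) * q%:R ^+ ((h + 1) * d + 1)).
Proof.
(* The error term can be zero: q^((h + 1) d) states suffice, a factor q below the claimed bound. *)
exists (fun _ _ _ => 0); split=> [delta delta_gt0|].
  by exists 0%N => *; rewrite normr0.
move=> p k _ F f d h p_pr k_gt0 -> cardF _ /degree_annihilator[P [P0 Pf sP]].
case=> -[P' [P'0 P'f <-]] _.
(* [P'] bounds the x-degree of [A] by h, and minimality against [P] bounds its y-degree by d. *)
have [A [A0 Af dA minA]] := min_annihilator P'0 P'f.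
have sA := leq_trans (minA _ P0 Pf) sP.
have A_sep := min_annihilator_separable p_pr k_gt0 cardF A0 Af minA.
have M_f := christol_dfao_generates p_pr k_gt0 cardF Af A_sep sA dA.
have [c [c_comp le_c]] := ex_is_comp M_f; exists c; split=> //.
rewrite addr0 mul1r -natrX ler_nat (leq_trans le_c) //.
by rewrite card_christol_state // leq_pexp2l ?expn_gt0 ?prime_gt0 ?leq_addr.
Qed.
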